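(* If $G$ and $H$ are limit aperiodic groups, then the direct product $G\times H$ is a limit aperiodic group.
   Context: For a group $G$ (not necessarily finitely generated) and a finite set $F$ with the discrete topology, $F^G$ denotes the set of all maps $G\to F$ with the product topology, and $G$ acts on $F^G$ by $(g\ast f)(a)=f(g^{-1}a)$. A map $\phi\in F^G$ is aperiodic if $b\ast\phi=\phi$ (with $b\in G$) implies $b=e$. A map $f\in F^G$ is limit aperiodic if every $\phi$ in the closure $\overline{\mathrm{Orb}_G(f)}$ of its $G$-orbit in $F^G$ is aperiodic. A group $G$ is limit aperiodic if there exist a finite set $F$ and a limit aperiodic map $f:G\to F$. *)

(* Defs.v *)
From HB Require Import structures.
From mathcomp Require Import all_boot.
From mathcomp Require Import all_classical topology.

Set Implicit Arguments.
Unset Strict Implicit.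
Unset Printing Implicit Defensive.

Local Open Scope group_scope.
Local Open Scope classical_set_scope.

(* F^G: all maps G -> F, with the product of the discrete topologies on F. *)
Definition fpow (G : groupType) (F : finType) : topologicalType :=
  {ptws G -> discrete_topology F}.

Definition translate (G : groupType) (F : finType) (g : G) (f : fpow G F) :
  fpow G F := fun a => f (g^-1 * a).

Definition orb (G : groupType) (F : finType) (f : fpow G F) : set (fpow G F) :=
  range (fun g : G => translate g f).

Definition aperiodic (G : groupType) (F : finType) (phi : fpow G F) : Prop :=
  forall b : G, translate b phi = phi -> b = 1.

Definition limit_aperiodic_map (G : groupType) (F : finType) (f : fpow G F) :
  Prop := forall phi : fpow G F, closure (orb f) phi -> aperiodic phi.

Definition limit_aperiodic (G : groupType) : Prop :=
  exists (F : finType) (f : fpow G F), limit_aperiodic_map f.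

(* Main.v *)
(** A limit of translates of the product map [(a, b) |-> (f a, h b)] is again a
    product map [(a, b) |-> (phi1 a, phi2 b)], where [phi1] and [phi2] are limits
    of translates of [f] and [h]. A period of the product map is then a pair of
    periods of the aperiodic maps [phi1] and [phi2]. *)
Require Import Defs.
From mathcomp Require Import all_boot.
From mathcomp Require Import all_classical topology.

Set Implicit Arguments.
Unset Strict Implicit.
Unset Printing Implicit Defensive.

Local Open Scope group_scope.
Local Open Scope classical_set_scope.

Lemma fpow_near_eq (G : groupType) (F : finType) (phi : fpow G F) (a : G) :
  \forall psi \near phi, psi a = phi a.
Proof.
exact: (@proj_continuous G (fun=> discrete_topology F) a phi _
          (discrete_set1 (phi a : discrete_topology F))).
Qed.

(** The product topology is the supremum of the topologies pulled back along evaluations, so one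
    coordinate can be tested at a time. *)
Lemma fpow_cvg (G : groupType) (F : finType) (U : set_system (fpow G F))
    (phi : fpow G F) : Filter U ->
  (forall a, \forall psi \near U, psi a = phi a) -> U --> phi.
Proof.
move=> FU Uphi; apply/cvg_sup => a A [_ [[B _ <-] Bphi] sBA].
by apply: filterS (Uphi a) => psi psia; apply: sBA; rewrite /= psia.
Qed.

Definition fpow_map (G K : groupType) (F E : finType) (q : K -> G)
    (r : F -> E) (phi : fpow G F) : fpow K E :=
  fun k => r (phi (q k)).

Lemma fpow_map_continuous (G K : groupType) (F E : finType) (q : K -> G)
    (r : F -> E) : continuous (@fpow_map G K F E q r).
Proof.
move=> phi.
apply: (@fpow_cvg _ _ _ _ (fmap_filter (fpow_map q r) (nbhs_filter phi))) => k.
apply: filterS (fpow_near_eq phi (q k)) => psi.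
exact: (@congr1 F E r).
Qed.

(** By continuity, a neighbourhood of the image pulls back to one of [phi], which meets [orb f]. *)
Lemma closure_orb_map (G K : groupType) (F E : finType) (q : K -> G)
    (r : F -> E) (f : fpow G F) (h : fpow K E) (phi : fpow G F) :
  (forall g, orb h (fpow_map q r (translate g f))) ->
  closure (orb f) phi -> closure (orb h) (fpow_map q r phi).
Proof.
move=> orbh clphi A /fpow_map_continuous/clphi [_ [[g _ <-] Ag]].
by exists (fpow_map q r (translate g f)).
Qed.

Definition fpow_prod (G H : groupType) (F E : finType) (f : fpow G F)
    (h : fpow H E) : fpow (G * H)%type (F * E)%type :=
  fun x => (f x.1, h x.2).

Lemma closure_orb_prod (G H : groupType) (F E : finType) (f : fpow G F)
    (h : fpow H E) (phi : fpow (G * H)%type (F * E)%type) :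
  closure (orb (fpow_prod f h)) phi ->
  exists (phi1 : fpow G F) (phi2 : fpow H E),
    [/\ closure (orb f) phi1, closure (orb h) phi2 & phi = fpow_prod phi1 phi2].
Proof.
move=> clphi.
(* The candidates are the slices of [phi] through the identity of the other factor; slicing a
   translate by [(c, d)] gives a translate by [c] or by [d]. *)
exists (fpow_map (fun a => (a, 1)) fst phi), (fpow_map (pair 1) snd phi); split.
- by apply: closure_orb_map clphi => -[c d]; exists c.
- by apply: closure_orb_map clphi => -[c d]; exists d.
apply/funext => -[a b].
(* One translate agrees with [phi] at all three points; being a product map, its value at [(a, b)]
   is read off from those at [(a, 1)] and [(1, b)]. *)
have [|_ [[[c d] _ <-] [<- [ea eb]]]] := clphi
    [set psi | psi (a, b) = phi (a, b) /\
               psi (a, 1) = phi (a, 1) /\ psi (1, b) = phi (1, b)].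
  by do ?apply: filterI; exact: fpow_near_eq.
by rewrite /fpow_prod /fpow_map -ea -eb.
Qed.

Theorem corollary3p7 (G H : groupType) :
  limit_aperiodic G -> limit_aperiodic H ->
  limit_aperiodic (G * H)%type.
Proof.
move=> [F [f apf]] [E [h aph]]; exists (F * E)%type, (fpow_prod f h).
move=> _ /closure_orb_prod[phi1 [phi2 [cl1 cl2 ->]]] [c d] period.
have eq_at a b := congr1 (fun psi => psi (a, b)) period.
congr (_, _).
(* The first components at [(a, 1)] show that [c] is a period of [phi1]. *)
- by apply: apf cl1 _ _; apply/funext => a; case: (eq_at a 1).
- by apply: aph cl2 _ _; apply/funext => b; case: (eq_at 1 b).
Qed.
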